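(* Let $q,q_1\in(0,1)$ with $q\neq q_1$, and let $T$ be a prefix code (tree) that is optimal for $\mathrm{TDGD}(q)$. Then $T$ is not optimal for $\mathrm{TDGD}(q_1)$.
   Context: Let $\mathcal{A}=\{(i,j): i,j\in\mathbb{Z}_{\ge 0}\}$. For $0<q<1$, $\mathrm{TDGD}(q)$ (two-dimensional geometric distribution) is the distribution on $\mathcal{A}$ given by $P(i,j)=(1-q)^2q^{i+j}$. A binary prefix code for $\mathcal{A}$ is identified with a (possibly infinite) full binary tree (every node is either a leaf or has exactly two children) whose leaves are in bijection with $\mathcal{A}$; the codeword length of a symbol is the depth of its leaf. A code is optimal for $\mathrm{TDGD}(q)$ if its expected codeword length $\sum_{(i,j)}P(i,j)\,\ell(i,j)$ is minimal among all binary prefix codes for $\mathcal{A}$. *)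

(* Defs.v *)
From Stdlib Require Import Reals List.
Import ListNotations.
Open Scope R_scope.

(* Nodes of a binary tree are addressed by their path from the root
   (false = left, true = right).  A (possibly infinite) full binary tree is
   a prefix-closed set of nodes containing the root in which every node has
   either both children or none. *)
Definition full_binary_tree (N : list bool -> Prop) : Prop :=
  N [] /\
  (forall p b, N (p ++ [b]) -> N p) /\
  (forall p, N p -> (N (p ++ [false]) <-> N (p ++ [true]))).

Definition is_leaf (N : list bool -> Prop) (p : list bool) : Prop :=
  N p /\ ~ N (p ++ [false]) /\ ~ N (p ++ [true]).

Definition prefix_code (N : list bool -> Prop) (c : nat * nat -> list bool) : Prop :=
  full_binary_tree N /\
  (forall a, is_leaf N (c a)) /\
  (forall a b, c a = c b -> a = b) /\
  (forall p, is_leaf N p -> exists a, c a = p).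

Definition tdgd (q : R) (i j : nat) : R := (1 - q) ^ 2 * q ^ (i + j).

(* Partial sums over the square [0..n]x[0..n] of P(i,j) * l(i,j).
   Terms are nonnegative, so the double series sums to L iff these
   partial sums converge to L. *)
Definition partial_exp_len (q : R) (c : nat * nat -> list bool) (n : nat) : R :=
  sum_f_R0 (fun i => sum_f_R0 (fun j => tdgd q i j * INR (length (c (i, j)))) n) n.

Definition has_expected_length (q : R) (c : nat * nat -> list bool) (L : R) : Prop :=
  Un_cv (partial_exp_len q c) L.

(* Optimal: finite expected length, no larger than that of any prefix code
   (codes with infinite expected length are never better). *)
Definition optimal (q : R) (N : list bool -> Prop) (c : nat * nat -> list bool) : Prop :=
  prefix_code N c /\
  exists L, has_expected_length q c L /\
    forall N' c' L', prefix_code N' c' -> has_expected_length q c' L' -> L <= L'.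

(* Main.v *)
(* In an optimal code, a node is at least as probable as every node strictly deeper
   than it and incomparable to it, since otherwise swapping the two subtrees would
   shorten the expected length.  Hence equiprobable leaves lie on at most two
   consecutive levels, and a long antidiagonal i + j = s contains 2^(M+1) leaves at
   a common depth d.  Swapping nodes of equal depth gathers 2^M (or 2^(M+1)) of these
   leaves into a complete subtree, rooted at depth d - M and of probability 2^M P(s).
   Comparing this root with a leaf on the antidiagonal s - k shows that this leaf has
   depth at most d - M - 1 if 2^(M+1) q^k < 1, and at least d - M if 1 < 2^M q1^k.
   For q < q1 both conditions hold for suitable k and M. *)
Require Import Defs.
From Stdlib Require Import Reals List.
From Stdlib Require Import Lra Lia Bool Arith Classical.
Import ListNotations.
Open Scope R_scope.

(** * Exchanging two subtrees of a binary tree *)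

Fixpoint strip (u p : list bool) : option (list bool) :=
  match u, p with
  | [], _ => Some p
  | b :: u', b' :: p' => if Bool.eqb b b' then strip u' p' else None
  | _ :: _, [] => None
  end.

Lemma strip_Some (u p r : list bool) : strip u p = Some r <-> p = u ++ r.
Proof.
revert p; induction u as [|b u IH]; intros [|b' p]; simpl.
- split; intro H; congruence.
- split; intro H; congruence.
- split; discriminate.
- destruct (eqb_spec b b') as [->|ne].
  + rewrite IH; split; intro H; congruence.
  + split; intro H; congruence.
Qed.

(** Boolean-valued, so that it can serve as an indicator function in sums over symbols. *)
Definition under (u p : list bool) : bool :=
  match strip u p with Some _ => true | None => false end.

Lemma under_iff (u p : list bool) : under u p = true <-> exists r, p = u ++ r.
Proof.
unfold under; destruct (strip u p) as [r|] eqn:E.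
- split; auto; intros _; exists r; now apply strip_Some.
- split; [discriminate|]; intros [r H]; apply strip_Some in H; congruence.
Qed.

(** The exchange of two subtrees is an action on addresses. For independent [u] and [v] it is an
    involution, so the new tree is the preimage of [N] under it and the new code is the old one
    followed by it. *)
Definition swap (u v p : list bool) : list bool :=
  match strip u p with
  | Some r => v ++ r
  | None => match strip v p with Some r => u ++ r | None => p end
  end.

(* Comparable nodes are excluded except equal ones, for which [swap] is the identity. *)
Definition independent (u v : list bool) : Prop :=
  forall r, (v = u ++ r -> r = []) /\ (u = v ++ r -> r = []).

Lemma independent_same_length (u v : list bool) :
  length u = length v -> independent u v.
Proof.
intros L r; split; intros ->; rewrite length_app in L; destruct r; simpl in L; auto; lia.
Qed.

Lemma independent_app (u v r r' : list bool) :
  independent u v -> u ++ r = v ++ r' -> u = v.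
Proof.
intros I E; destruct (app_eq_app _ _ _ _ E) as [l [[E1 _]|[E1 _]]];
  destruct (I l) as [I1 I2].
- rewrite (I2 E1), app_nil_r in E1; auto.
- rewrite (I1 E1), app_nil_r in E1; auto.
Qed.

Lemma swap_l (u v r : list bool) : swap u v (u ++ r) = v ++ r.
Proof.
unfold swap; destruct (strip u (u ++ r)) as [r'|] eqn:E.
- apply strip_Some, app_inv_head in E; congruence.
- assert (H : strip u (u ++ r) = Some r) by now apply strip_Some.
  congruence.
Qed.

Lemma swap_r (u v r : list bool) :
  independent u v -> swap u v (v ++ r) = u ++ r.
Proof.
intros I; unfold swap; destruct (strip u (v ++ r)) as [r'|] eqn:E.
- apply strip_Some in E; pose proof (independent_app _ _ _ _ I (eq_sym E)); subst v.
  now apply app_inv_head in E; subst.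
- assert (H : strip v (v ++ r) = Some r) by now apply strip_Some.
  now rewrite H.
Qed.

Lemma swap_other (u v p : list bool) :
  under u p = false -> under v p = false -> swap u v p = p.
Proof.
unfold under, swap; destruct (strip u p), (strip v p); congruence.
Qed.

Lemma swap_cases (u v p : list bool) : independent u v ->
  (exists r, p = u ++ r /\ swap u v p = v ++ r) \/
  (exists r, p = v ++ r /\ swap u v p = u ++ r) \/
  (under u p = false /\ under v p = false /\ swap u v p = p).
Proof.
intros I; destruct (under u p) eqn:E.
- left; apply under_iff in E; destruct E as [r ->]; exists r; now rewrite swap_l.
- right; destruct (under v p) eqn:E'.
  + left; apply under_iff in E'; destruct E' as [r ->]; exists r.
    now rewrite swap_r.
  + right; repeat split; auto; now apply swap_other.
Qed.

Lemma swap_involutive (u v p : list bool) :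
  independent u v -> swap u v (swap u v p) = p.
Proof.
intros I; destruct (swap_cases u v p I) as [(r & -> & E)|[(r & -> & E)|(_ & _ & E)]];
  rewrite E; auto using swap_l, swap_r.
Qed.

Lemma swap_short (u v p : list bool) :
  (length p < length u)%nat -> (length p < length v)%nat -> swap u v p = p.
Proof.
intros Lu Lv; apply swap_other; apply not_true_iff_false; rewrite under_iff;
  intros [r ->]; rewrite length_app in *; lia.
Qed.

(** A node [w] at least as deep as [u] and [v] is either inside one of the two subtrees or
    incomparable to both roots, and the same then holds for everything below [w]. *)
Lemma swap_app (u v w r : list bool) : independent u v ->
  (length u <= length w)%nat -> (length v <= length w)%nat ->
  swap u v (w ++ r) = swap u v w ++ r.
Proof.
intros I Lu Lv.
destruct (swap_cases u v w I) as [(r' & -> & E)|[(r' & -> & E)|(Eu & Ev & E)]]; rewrite E.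
- now rewrite <- !app_assoc, swap_l.
- now rewrite <- !app_assoc, swap_r.
- assert (K : forall x, (length x <= length w)%nat -> under x w = false ->
      under x (w ++ r) = false).
  { intros x Lx Ex; apply not_true_iff_false; rewrite under_iff; intros [r' H].
    destruct (app_eq_app _ _ _ _ H) as [l [[E1 _]|[E1 _]]].
    - assert (T : under x w = true) by (apply under_iff; eauto); congruence.
    - assert (l = []) by (rewrite E1, length_app in Lx; destruct l; simpl in Lx; auto; lia).
      subst l; rewrite app_nil_r in E1; subst x.
      assert (T : under w w = true)
        by (apply under_iff; exists []; now rewrite app_nil_r).
      congruence. }
  now apply swap_other; apply K.
Qed.

Lemma under_swap (u v w p : list bool) :
  length u = length v -> (length u <= length w)%nat ->
  under (swap u v w) (swap u v p) = under w p.
Proof.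
intros L Lw.
assert (I := independent_same_length u v L).
assert (Lsw : length (swap u v w) = length w).
{ destruct (swap_cases u v w I) as [(r & -> & E)|[(r & -> & E)|(_ & _ & E)]]; rewrite E;
    rewrite ?length_app; lia. }
apply eq_true_iff_eq; rewrite !under_iff; split; intros [r H]; exists r.
- rewrite <- (swap_involutive u v p I), H, swap_app, swap_involutive; auto; lia.
- rewrite H, swap_app; auto; lia.
Qed.

(** The two addresses differ only if stepping from [p] to its child enters one of the subtrees at
    its root. They are then [u] and [v] in some order, both nodes of [N]. *)
Lemma swap_child (N : list bool -> Prop) (u v p : list bool) (b : bool) :
  independent u v -> N u -> N v ->
  N (swap u v (p ++ [b])) <-> N (swap u v p ++ [b]).
Proof.
intros I Nu Nv.
destruct (swap_cases u v p I) as [(r & -> & E)|[(r & -> & E)|(Eu & Ev & E)]]; rewrite E.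
- now rewrite <- !app_assoc, swap_l.
- now rewrite <- !app_assoc, swap_r.
- assert (K : forall x r, under x p = false -> p ++ [b] = x ++ r -> r = [] /\ x = p ++ [b]).
  { intros x r Ex H; destruct r as [|b' r _] using rev_ind.
    - now rewrite app_nil_r in H.
    - rewrite app_assoc in H; apply app_inj_tail in H; destruct H as [H _].
      assert (under x p = true) by (apply under_iff; eauto); congruence. }
  destruct (swap_cases u v (p ++ [b]) I) as [(r & E1 & E2)|[(r & E1 & E2)|(_ & _ & E2)]];
    rewrite E2; try tauto.
  + destruct (K u r Eu E1) as [-> <-]; rewrite app_nil_r; tauto.
  + destruct (K v r Ev E1) as [-> <-]; rewrite app_nil_r; tauto.
Qed.

Lemma prefix_code_swap (N : list bool -> Prop) (c : nat * nat -> list bool)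
    (u v : list bool) :
  prefix_code N c -> independent u v -> N u -> N v ->
  prefix_code (fun p => N (swap u v p)) (fun a => swap u v (c a)).
Proof.
intros ((N0 & Nup & Nsib) & Hleaf & Hinj & Hsurj) I Nu Nv.
assert (Hl : forall p, is_leaf (fun p => N (swap u v p)) p <-> is_leaf N (swap u v p)).
{ intro p; unfold is_leaf; rewrite !swap_child by assumption; tauto. }
split; [split; [|split]|split; [|split]].
- destruct (swap_cases u v [] I) as [(r & E1 & E2)|[(r & E1 & E2)|(_ & _ & E2)]];
    rewrite E2; auto;
    symmetry in E1; apply app_eq_nil in E1; destruct E1 as [-> ->]; now rewrite app_nil_r.
- intros p b H; apply swap_child in H; eauto.
- intros p H; rewrite !swap_child by assumption; auto.
- intro a; rewrite Hl, swap_involutive; auto.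
- intros a b H; apply Hinj.
  rewrite <- (swap_involutive u v (c a) I), H; now apply swap_involutive.
- intros p H; apply Hl in H; destruct (Hsurj _ H) as [a E]; exists a.
  rewrite E; now apply swap_involutive.
Qed.

(** * Gathering nodes of equal depth into a complete subtree *)

Lemma node_prefix (N : list bool -> Prop) (p r : list bool) :
  full_binary_tree N -> N (p ++ r) -> N p.
Proof.
intros (_ & Nup & _); induction r as [|b r IH] using rev_ind.
- now rewrite app_nil_r.
- rewrite app_assoc; intro H; eauto.
Qed.

Lemma node_sibling (N : list bool -> Prop) (p : list bool) (b : bool) :
  full_binary_tree N -> N (p ++ [b]) -> N (p ++ [negb b]).
Proof.
intros (_ & Nup & Nsib) H; specialize (Nsib p (Nup _ _ H)).
destruct b; simpl; tauto.
Qed.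

Lemma leaf_extension (N : list bool -> Prop) (p r : list bool) :
  full_binary_tree N -> is_leaf N p -> N (p ++ r) -> r = [].
Proof.
intros F (_ & H0 & H1) H; destruct r as [|b r]; auto; exfalso.
replace (p ++ b :: r) with ((p ++ [b]) ++ r) in H by now rewrite <- app_assoc.
apply node_prefix in H; auto; destruct b; auto.
Qed.

(** One level of gathering, by induction on the number of pairs in [xs]: the sibling of the first
    node is swapped with the second node, so that their common parent covers exactly what the pair
    covered. The list [ys] accumulates these parents. All swaps are between equal depths, hence no
    codeword length changes. *)
Lemma pair_up (d k : nat) (N : list bool -> Prop) (c : nat * nat -> list bool)
    (xs ys : list (list bool)) :
  prefix_code N c ->
  length xs = (2 * k)%nat -> NoDup xs -> NoDup ys ->
  (forall x, In x xs -> N x /\ length x = S d) ->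
  (forall y, In y ys -> N y /\ length y = d) ->
  (forall x y, In x xs -> In y ys -> under y x = false) ->
  exists N' c' zs, prefix_code N' c' /\
    (forall a, length (c' a) = length (c a)) /\
    length zs = (k + length ys)%nat /\ NoDup zs /\
    (forall z, In z zs -> N' z /\ length z = d) /\
    (forall a, (exists z, In z zs /\ under z (c' a) = true) <->
      (exists w, In w (xs ++ ys) /\ under w (c a) = true)).
Proof.
revert N c xs ys; induction k as [|k IH]; intros N c xs ys PC Lx Dx Dy Hx Hy Hxy.
{ destruct xs; [|discriminate]; exists N, c, ys.
  do 5 (split; auto); intro a; reflexivity. }
destruct xs as [|x1 [|x2 rest]]; simpl in Lx; try lia.
destruct (Hx x1) as [N1 L1]; [now left|].
destruct (Hx x2) as [N2 L2]; [now right; left|].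
assert (Hb : exists y0 b, x1 = y0 ++ [b]).
{ destruct x1 as [|b y0 _] using rev_ind; [discriminate|eauto]. }
destruct Hb as (y0 & b & ->).
assert (Ly0 : length y0 = d) by (rewrite length_app in L1; simpl in L1; lia).
assert (F : full_binary_tree N) by apply PC.
(* If [x2] already is the sibling [s1], the swap is the identity, so this case needs no separate
   treatment. *)
set (s1 := y0 ++ [negb b]).
assert (Ns : N s1) by now apply node_sibling.
assert (Ls : length s1 = S d) by (unfold s1; rewrite length_app; simpl; lia).
assert (Es : length s1 = length x2) by congruence.
assert (I := independent_same_length _ _ Es).
assert (Sx1 : swap s1 x2 (y0 ++ [b]) = y0 ++ [b]).
{ apply swap_other; apply not_true_iff_false; rewrite under_iff; intros [r E].
  all: assert (r = []) by (eapply independent_same_length; [|exact E]; congruence).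
  all: subst r; rewrite app_nil_r in E.
  - unfold s1 in E; apply app_inj_tail in E; destruct E as [_ E]; now destruct b.
  - inversion Dx; subst; simpl in *; tauto. }
assert (Sx2 : swap s1 x2 x2 = s1).
{ rewrite <- (app_nil_r x2) at 2; rewrite swap_r, app_nil_r; auto. }
assert (Ss1 : swap s1 x2 s1 = x2) by (rewrite <- Sx2 at 2; now apply swap_involutive).
assert (Sl : forall p, length (swap s1 x2 p) = length p).
{ intro p; destruct (swap_cases s1 x2 p I) as [(r & -> & E)|[(r & -> & E)|(_ & _ & E)]];
    rewrite E, ?length_app; lia. }
assert (Sh : forall y, length y = d -> swap s1 x2 y = y) by (intros; apply swap_short; lia).
assert (under0 : forall y, In y ys -> under y s1 = false).
{ intros y Iy; apply not_true_iff_false; rewrite under_iff; intros [r E].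
  destruct (Hy y Iy) as [_ Ly].
  assert (E' : y = y0).
  { apply independent_app with (2 := eq_sym E), independent_same_length; congruence. }
  subst y; specialize (Hxy (y0 ++ [b]) y0 (or_introl eq_refl) Iy).
  assert (under y0 (y0 ++ [b]) = true) by (apply under_iff; eauto); congruence. }
destruct (IH (fun p => N (swap s1 x2 p)) (fun a => swap s1 x2 (c a))
  (map (swap s1 x2) rest) (y0 :: ys)) as (N' & c' & zs & PC' & Lc & Lz & Dz & Hz & Hcov).
- now apply prefix_code_swap.
- rewrite length_map; lia.
- apply NoDup_map_NoDup_ForallPairs.
  + intros p p' _ _ E; rewrite <- (swap_involutive s1 x2 p I), E; now apply swap_involutive.
  + now inversion Dx as [|? ? _ D]; inversion D.
- constructor; auto; intro Iy.
  specialize (Hxy (y0 ++ [b]) y0 (or_introl eq_refl) Iy).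
  assert (under y0 (y0 ++ [b]) = true) by (apply under_iff; eauto); congruence.
- intros x Ix; apply in_map_iff in Ix; destruct Ix as (w & <- & Iw).
  rewrite swap_involutive, Sl by assumption; apply Hx; simpl; auto.
- intros y [<-|Iy].
  + rewrite Sh by assumption; split; auto; apply node_prefix with (1 := F) in N1; auto.
  + rewrite Sh by now apply Hy.
    now apply Hy.
- intros x y Ix Iy; apply in_map_iff in Ix; destruct Ix as (w & <- & Iw).
  destruct (Hx w) as [_ Lw]; [simpl; auto|].
  destruct Iy as [<-|Iy]; apply not_true_iff_false; intro U.
  (* A node of depth [S d] below [y0] is one of its two children. Swapped back, these are the first
     node and [x2], and neither occurs in [rest] because [xs] has no duplicates. *)
  + apply under_iff in U; destruct U as [r E].
    assert (Lr := f_equal (@length bool) E); rewrite Sl, Lw, length_app, Ly0 in Lr.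
    destruct r as [|b' [|]]; simpl in Lr; try lia.
    apply (f_equal (swap s1 x2)) in E; rewrite swap_involutive in E by assumption.
    apply NoDup_cons_iff in Dx; destruct Dx as [D1 D].
    apply NoDup_cons_iff in D; destruct D as [D2 _].
    destruct (bool_dec b' b) as [->|ne].
    * rewrite Sx1 in E; subst w; apply D1; simpl; auto.
    * replace b' with (negb b) in * by (destruct b, b'; simpl; congruence).
      fold s1 in E; rewrite Ss1 in E; subst w; auto.
  + destruct (swap_cases s1 x2 w I) as [(r & Ew & E)|[(r & Ew & E)|(_ & _ & E)]].
    * rewrite Ew, length_app in Lw; destruct r; simpl in Lw; [|lia].
      rewrite app_nil_r in E; rewrite E in U; rewrite Hxy in U; simpl; auto; discriminate.
    * rewrite Ew, length_app in Lw; destruct r; simpl in Lw; [|lia].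
      rewrite app_nil_r in E; rewrite E in U; rewrite under0 in U; simpl; auto; discriminate.
    * rewrite E, Hxy in U; simpl; auto; discriminate.
- exists N', c', zs; split; [|split; [|split; [|split; [|split]]]]; auto.
  + intro a; rewrite Lc; apply Sl.
  + simpl in Lz; lia.
  + intro a; rewrite Hcov.
    assert (Lf : is_leaf N (c a)) by apply PC.
    assert (U : forall w, length w = S d ->
      under (swap s1 x2 w) (swap s1 x2 (c a)) = under w (c a))
      by (intros; apply under_swap; lia).
    (* Both swapped nodes are deeper than [y] and lie outside its subtree, so nothing enters or
       leaves that subtree. *)
    assert (Uy : forall y, In y ys -> under y (swap s1 x2 (c a)) = under y (c a)).
    { intros y Iy; destruct (Hy y Iy) as [_ Ly].
      assert (K : forall x r, length x = S d -> under y (x ++ r) = under y x).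
      { intros x r Lx'; apply eq_true_iff_eq; rewrite !under_iff; split.
        - intros [r' E]; destruct (app_eq_app _ _ _ _ E) as [l [[E1 _]|[E1 _]]]; eauto.
          apply (f_equal (@length bool)) in E1; rewrite length_app in E1; lia.
        - intros [r' ->]; exists (r' ++ r); now rewrite app_assoc. }
      destruct (swap_cases s1 x2 (c a) I) as [(r & E1 & E)|[(r & E1 & E)|(_ & _ & E)]];
        rewrite E; auto; rewrite E1, !K by assumption;
        rewrite under0, Hxy; simpl; auto. }
    (* After the swap the children of [y0] carry the subtrees of the two paired nodes. No codeword
       ends at [y0] itself, which is an inner node. *)
    assert (U0 : under y0 (swap s1 x2 (c a)) = true <->
      under (y0 ++ [b]) (c a) = true \/ under x2 (c a) = true).
    { rewrite <- (U (y0 ++ [b]) L1), <- (U x2 L2), Sx1, Sx2, !under_iff; split.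
      - intros [[|b' r] E].
        + exfalso; rewrite app_nil_r in E; apply (f_equal (swap s1 x2)) in E.
          rewrite swap_involutive, Sh in E by assumption; rewrite E in Lf.
          assert (H := leaf_extension _ _ _ F Lf N1); discriminate.
        + destruct (bool_dec b' b) as [->|ne].
          * left; exists r; now rewrite <- app_assoc.
          * right; exists r; rewrite E; unfold s1; rewrite <- app_assoc; simpl.
            replace (negb b) with b' by (destruct b, b'; simpl; congruence); auto.
      - intros [[r E]|[r E]]; rewrite E; [|unfold s1]; rewrite <- app_assoc; eauto. }
    split.
    * intros (w & Iw & Uw); apply in_app_or in Iw; destruct Iw as [Iw|[<-|Iw]].
      -- apply in_map_iff in Iw; destruct Iw as (w' & <- & Iw).
         rewrite U in Uw by (apply Hx; simpl; auto).
         exists w'; split; auto; simpl; rewrite in_app_iff; auto.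
      -- apply U0 in Uw; destruct Uw; [exists (y0 ++ [b])|exists x2]; simpl; auto.
      -- rewrite Uy in Uw by assumption; exists w; split; auto.
         simpl; rewrite in_app_iff; auto.
    * intros (w & Iw & Uw); simpl in Iw; rewrite in_app_iff in Iw.
      destruct Iw as [<-|[<-|[Iw|Iw]]].
      -- exists y0; split; [rewrite in_app_iff; simpl; auto|]; tauto.
      -- exists y0; split; [rewrite in_app_iff; simpl; auto|]; tauto.
      -- exists (swap s1 x2 w); split.
         ++ apply in_or_app; left; now apply in_map.
         ++ rewrite U; auto; apply Hx; simpl; auto.
      -- exists w; split; [rewrite in_app_iff; simpl; auto|].
         now rewrite Uy.
Qed.

(** Each round of [pair_up], started with no parents, halves the number of nodes and moves up one
    level, so [M] rounds leave a single node. *)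
Lemma gather (M d : nat) (N : list bool -> Prop) (c : nat * nat -> list bool)
    (xs : list (list bool)) :
  prefix_code N c -> length xs = (2 ^ M)%nat -> NoDup xs ->
  (forall x, In x xs -> N x /\ length x = d) ->
  exists N' c' u, prefix_code N' c' /\
    (forall a, length (c' a) = length (c a)) /\
    N' u /\ (length u + M = d)%nat /\
    (forall a, under u (c' a) = true <-> exists x, In x xs /\ under x (c a) = true).
Proof.
revert d N c xs; induction M as [|M IH]; intros d N c xs PC Lx Dx Hx.
- destruct xs as [|x [|]]; try discriminate.
  destruct (Hx x (or_introl eq_refl)) as [Nx L].
  exists N, c, x; split; [|split; [|split; [|split]]]; auto; try lia.
  intro a; split; [eauto using in_eq|]; intros (y & [<-|[]] & H); auto.
- destruct d as [|d].
  (* Depth 0 contains only the root, whereas at least two distinct nodes are given. *)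
  { assert (P := Nat.pow_nonzero 2 M ltac:(lia)); simpl in Lx.
    destruct xs as [|x1 [|x2 xs]]; simpl in Lx; try lia.
    destruct (Hx x1) as [_ L1], (Hx x2) as [_ L2]; simpl; auto.
    destruct x1, x2; try discriminate.
    inversion Dx as [|? ? D]; exfalso; apply D; simpl; auto. }
  destruct (pair_up d (2 ^ M) N c xs []) as (N1 & c1 & zs & PC1 & Lc1 & Lz & Dz & Hz & Hcov);
    auto using NoDup_nil; try (simpl; intros; tauto).
  destruct (IH d N1 c1 zs) as (N' & c' & u & PC' & Lc & Nu & Lu & Hu); auto.
  { rewrite Lz; simpl; lia. }
  exists N', c', u; split; [|split; [|split; [|split]]]; auto; try lia.
  + intro a; now rewrite Lc.
  + intro a; rewrite Hu, Hcov, app_nil_r; tauto.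
Qed.

(** * Double sums over squares and probabilities of sets of symbols *)

(** With probability times length as summand, this is convertible to [partial_exp_len], so expected
    lengths can be compared termwise. *)
Definition dsum (n : nat) (f : nat * nat -> R) : R :=
  sum_f_R0 (fun i => sum_f_R0 (fun j => f (i, j)) n) n.

Lemma dsum_ext (n : nat) (f g : nat * nat -> R) :
  (forall a, f a = g a) -> dsum n f = dsum n g.
Proof. intros H; unfold dsum; apply sum_eq; intros; apply sum_eq; auto. Qed.

Lemma dsum_le (n : nat) (f g : nat * nat -> R) :
  (forall a, f a <= g a) -> dsum n f <= dsum n g.
Proof. intros H; unfold dsum; apply sum_Rle; intros; apply sum_Rle; auto. Qed.

Lemma dsum_plus (n : nat) (f g : nat * nat -> R) :
  dsum n (fun a => f a + g a) = dsum n f + dsum n g.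
Proof.
unfold dsum; rewrite <- sum_plus; apply sum_eq; intros; apply sum_plus.
Qed.

Lemma dsum_scal (n : nat) (f : nat * nat -> R) (x : R) :
  dsum n (fun a => f a * x) = dsum n f * x.
Proof.
unfold dsum; rewrite (Rmult_comm _ x), scal_sum; apply sum_eq; intros.
now rewrite Rmult_comm, scal_sum.
Qed.

Lemma sum_single (g : nat -> R) (i n : nat) :
  (forall j, j <> i -> g j = 0) -> (i <= n)%nat -> sum_f_R0 g n = g i.
Proof.
intros H; induction n as [|n IH]; intros L; simpl.
- now replace i with 0%nat by lia.
- destruct (Nat.eq_dec i (S n)) as [->|ne].
  + replace (sum_f_R0 g n) with 0; [lra|].
    symmetry; rewrite <- (sum_eq (fun _ => 0)).
    * clear; induction n; simpl; lra.
    * intros j Lj; symmetry; apply H; lia.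
  + rewrite IH, (H (S n)) by lia; lra.
Qed.

Lemma dsum_single (n : nat) (f : nat * nat -> R) (i j : nat) :
  (forall b, b <> (i, j) -> f b = 0) -> (i <= n)%nat -> (j <= n)%nat ->
  dsum n f = f (i, j).
Proof.
intros H Li Lj; unfold dsum.
rewrite (sum_single _ i); auto.
- apply (sum_single (fun j => f (i, j))); auto; intros; apply H; congruence.
- intros i' ne; rewrite (sum_single _ 0); try lia; intros; apply H; congruence.
Qed.

Lemma dsum_growing (f : nat * nat -> R) :
  (forall a, 0 <= f a) -> Un_growing (fun n => dsum n f).
Proof.
intros H n; unfold dsum; rewrite (tech5 _ n).
assert (0 <= sum_f_R0 (fun j => f (S n, j)) (S n)) by (apply cond_pos_sum; auto).
enough (sum_f_R0 (fun i => sum_f_R0 (fun j => f (i, j)) n) n <=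
  sum_f_R0 (fun i => sum_f_R0 (fun j => f (i, j)) (S n)) n) by lra.
apply sum_Rle; intros i _; rewrite tech5; specialize (H (i, S n)); lra.
Qed.

Definition prob (q : R) (a : nat * nat) : R := tdgd q (fst a) (snd a).

Lemma prob_pos (q : R) (a : nat * nat) : 0 < q < 1 -> 0 < prob q a.
Proof. intros H; apply Rmult_lt_0_compat; apply pow_lt; lra. Qed.

Lemma dsum_prob_le_1 (q : R) (n : nat) : 0 < q < 1 -> dsum n (prob q) <= 1.
Proof.
intros H; set (g := sum_f_R0 (fun i => q ^ i) n).
(* The double sum factors into two geometric sums. The factor [q - 1] fits [GP_finite], and the
   square absorbs its sign. *)
assert (E : dsum n (prob q) = (g * (q - 1)) ^ 2).
{ transitivity (g * (g * (1 - q) ^ 2)); [|ring].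
  unfold dsum, prob, tdgd; simpl fst; simpl snd.
  rewrite (Rmult_comm g (g * _)); unfold g at 2; rewrite scal_sum; apply sum_eq; intros i _.
  rewrite (Rmult_comm g), <- Rmult_assoc; unfold g; rewrite scal_sum; apply sum_eq.
  intros j _; rewrite pow_add; ring. }
rewrite E; unfold g; rewrite GP_finite.
assert (0 < q ^ (n + 1)) by (apply pow_lt; lra).
destruct (pow_lt_1_compat q (n + 1)); try lra; [lia|]; nra.
Qed.

Definition ind (b : bool) : R := if b then 1 else 0.

Definition weight (q : R) (S : nat * nat -> bool) (n : nat) : R :=
  dsum n (fun a => prob q a * ind (S a)).

Lemma under_refl (u : list bool) : under u u = true.
Proof. apply under_iff; exists []; now rewrite app_nil_r. Qed.

Lemma under_codeword (N : list bool -> Prop) (c : nat * nat -> list bool)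
    (a b : nat * nat) :
  prefix_code N c -> under (c a) (c b) = true -> a = b.
Proof.
intros (F & Hleaf & Hinj & _) H; apply Hinj; apply under_iff in H; destruct H as [r E].
assert (r = []) by (eapply leaf_extension; [exact F|apply Hleaf|rewrite <- E; apply Hleaf]).
now subst r; rewrite app_nil_r in E.
Qed.

Lemma weight_cv (q : R) (S : nat * nat -> bool) :
  0 < q < 1 -> exists w, Un_cv (weight q S) w.
Proof.
intros H; apply Un_cv_crit.
- apply dsum_growing; intro a; assert (P := prob_pos q a H).
  unfold ind; destruct (S a); lra.
- exists 1; intros x [n ->]; apply Rle_trans with (2 := dsum_prob_le_1 q n H).
  apply dsum_le; intro a; assert (P := prob_pos q a H); unfold ind; destruct (S a); lra.
Qed.

Lemma weight_mono (q : R) (S S' : nat * nat -> bool) (w w' : R) :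
  0 < q < 1 -> (forall a, S a = true -> S' a = true) ->
  Un_cv (weight q S) w -> Un_cv (weight q S') w' -> w <= w'.
Proof.
intros H HS; apply Rle_cv_lim; intro n; apply dsum_le; intro a.
assert (P := prob_pos q a H); specialize (HS a).
unfold ind; destruct (S a), (S' a); try lra; discriminate HS; auto.
Qed.

Definition symbol_dec (a b : nat * nat) : {a = b} + {a <> b}.
Proof. decide equality; apply Nat.eq_dec. Defined.

Definition mem (l : list (nat * nat)) (a : nat * nat) : bool :=
  if in_dec symbol_dec a l then true else false.

Lemma mem_iff (l : list (nat * nat)) (a : nat * nat) : mem l a = true <-> In a l.
Proof. unfold mem; destruct (in_dec symbol_dec a l); intuition discriminate. Qed.

Definition total (q : R) (l : list (nat * nat)) : R :=
  fold_right (fun a r => prob q a + r) 0 l.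

(** The partial sums are constant once the square contains every entry of [l]. A repeated entry
    would be counted twice by [total] but once by [mem]. *)
Lemma weight_list (q : R) (l : list (nat * nat)) : NoDup l ->
  Un_cv (weight q (mem l)) (total q l).
Proof.
intros D e He; assert (K : exists K, forall n, (n >= K)%nat ->
  weight q (mem l) n = total q l).
{ clear e He; induction D as [|[i j] l ni D IH].
  - exists 0%nat; intros n _; unfold weight; change (total q []) with 0.
    rewrite <- (Rmult_0_r (dsum n (prob q))).
    now rewrite <- dsum_scal.
  - destruct IH as [K HK]; exists (max K (max i j)); intros n Ln.
    change (total q ((i, j) :: l)) with (prob q (i, j) + total q l).
    rewrite <- (HK n) by lia; unfold weight.
    rewrite <- (Rmult_1_r (prob q (i, j))).
    replace (prob q (i, j) * 1) with
      (dsum n (fun a => prob q a * ind (mem [(i, j)] a))).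
    + rewrite <- dsum_plus; apply dsum_ext; intro a; unfold mem.
      destruct (in_dec symbol_dec a ((i, j) :: l)) as [[E|I]|I],
        (in_dec symbol_dec a [(i, j)]) as [[E'|[]]|I'],
        (in_dec symbol_dec a l) as [I''|I'']; unfold ind; simpl in *; subst;
        try lra; tauto.
    + rewrite (dsum_single n _ i j); try lia.
      * unfold mem; destruct (in_dec _ _ _) as [|I]; simpl in *; auto; tauto.
      * intros b ne; unfold mem; destruct (in_dec _ _ _) as [[|[]]|I]; simpl; [congruence|].
        lra. }
destruct K as [K HK]; exists K; intros n Ln; rewrite HK by auto.
unfold Rdist; rewrite Rminus_diag, Rabs_R0; lra.
Qed.

(** * Probability of a subtree and the exchange inequality *)

Definition mass (q : R) (c : nat * nat -> list bool) (u : list bool) (w : R) : Prop :=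
  Un_cv (weight q (fun a => under u (c a))) w.

Lemma mass_ge (q : R) (c : nat * nat -> list bool) (u : list bool) (w : R)
    (l : list (nat * nat)) :
  0 < q < 1 -> NoDup l -> (forall a, In a l -> under u (c a) = true) ->
  mass q c u w -> total q l <= w.
Proof.
intros Hq D H M; eapply weight_mono; [exact Hq| |now apply weight_list|exact M].
intros a Ha; apply H; now apply mem_iff.
Qed.

Lemma mass_le (q : R) (c : nat * nat -> list bool) (u : list bool) (w : R)
    (l : list (nat * nat)) :
  0 < q < 1 -> NoDup l -> (forall a, under u (c a) = true -> In a l) ->
  mass q c u w -> w <= total q l.
Proof.
intros Hq D H M; eapply weight_mono; [exact Hq| |exact M|now apply weight_list].
intros a Ha; now apply mem_iff, H.
Qed.

Lemma codeword_mass (q : R) (N : list bool -> Prop) (c : nat * nat -> list bool)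
    (a : nat * nat) (w : R) :
  0 < q < 1 -> prefix_code N c -> mass q c (c a) w -> w = prob q a.
Proof.
intros Hq PC M; assert (D : NoDup [a]) by (constructor; [intros []|constructor]).
replace (prob q a) with (total q [a]) by (simpl; lra); apply Rle_antisym.
- apply (mass_le q c (c a)); auto; intros b Hb; left; eapply under_codeword; eauto.
- apply (mass_ge q c (c a)); auto; intros ? [<-|[]]; apply under_refl.
Qed.

(* Swapping the subtrees at [u] and [v] changes the expected length by
   (|v| - |u|) (W u - W v). *)
Lemma optimal_exchange (q : R) (N : list bool -> Prop) (c : nat * nat -> list bool)
    (u v : list bool) (wu wv : R) :
  0 < q < 1 -> optimal q N c -> N u -> N v -> independent u v ->
  (length u < length v)%nat -> mass q c u wu -> mass q c v wv -> wv <= wu.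
Proof.
intros Hq (PC & L & HL & Hopt) Nu Nv I Luv Mu Mv.
assert (ne : u <> v) by (intros ->; lia).
assert (C : has_expected_length q (fun a => swap u v (c a))
  (L + (wu - wv) * (INR (length v) - INR (length u)))).
{ assert (C := CV_plus _ _ _ _ HL (CV_mult _ _ _ _ (CV_minus _ _ _ _ Mu Mv)
    (CV_shift (fun _ => INR (length v) - INR (length u)) 0 _ ltac:(
      intros e He; exists 0%nat; intros n _;
      unfold Rdist; rewrite Rminus_diag, Rabs_R0; exact He)))).
  intros e He; destruct (C e He) as [K HK]; exists K; intros n Ln.
  specialize (HK n Ln); cbv beta in HK.
  replace (partial_exp_len q (fun a => swap u v (c a)) n) with
    (partial_exp_len q c n +
      (weight q (fun a => under u (c a)) n - weight q (fun a => under v (c a)) n) *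
      (INR (length v) - INR (length u))); auto.
  change (dsum n (fun a => prob q a * INR (length (c a))) +
    (weight q (fun a => under u (c a)) n - weight q (fun a => under v (c a)) n) *
      (INR (length v) - INR (length u)) =
    dsum n (fun a => prob q a * INR (length (swap u v (c a))))).
  replace (weight q (fun a => under u (c a)) n - weight q (fun a => under v (c a)) n)
    with (weight q (fun a => under u (c a)) n + weight q (fun a => under v (c a)) n * -1)
    by ring.
  unfold weight; rewrite <- dsum_scal, <- dsum_plus, <- dsum_scal, <- dsum_plus.
  apply dsum_ext; intro a.
  (* The subtrees at [u] and [v] are disjoint, so at most one of the two indicators is 1 for a given
     symbol. *)
  assert (K' : forall r, under v (u ++ r) = false /\ under u (v ++ r) = false).
  { intro r; split; apply not_true_iff_false; rewrite under_iff; intros [r' E].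
    - apply ne; eapply independent_app; eauto.
    - apply ne; symmetry in E; eapply independent_app; eauto. }
  assert (T : forall w r, under w (w ++ r) = true) by (intros; apply under_iff; eauto).
  destruct (swap_cases u v (c a) I) as [(r & E1 & E)|[(r & E1 & E)|(E1 & E2 & E)]];
    rewrite E.
  - rewrite E1, T, (proj1 (K' r)), !length_app, !plus_INR; simpl; ring.
  - rewrite E1, T, (proj2 (K' r)), !length_app, !plus_INR; simpl; ring.
  - rewrite E1, E2; simpl; ring. }
assert (H := Hopt _ _ _ (prefix_code_swap N c u v PC I Nu Nv) C).
apply lt_INR in Luv; nra.
Qed.

Lemma optimal_same_lengths (q : R) (N N' : list bool -> Prop)
    (c c' : nat * nat -> list bool) :
  optimal q N c -> prefix_code N' c' -> (forall a, length (c' a) = length (c a)) ->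
  optimal q N' c'.
Proof.
intros (PC & L & HL & Hopt) PC' E; split; auto; exists L; split; auto.
intros e He; destruct (HL e He) as [K HK]; exists K; intros n Ln.
replace (partial_exp_len q c' n) with (partial_exp_len q c n); auto.
unfold partial_exp_len; apply sum_eq; intros; apply sum_eq; intros; now rewrite E.
Qed.

(** * Depths of equiprobable codewords *)

Lemma leaf_independent (N : list bool -> Prop) (p z : list bool) :
  full_binary_tree N -> is_leaf N p -> N z -> under z p = false -> independent z p.
Proof.
intros F Lp Nz E r; split; intros ->.
- assert (under z (z ++ r) = true) by (apply under_iff; eauto); congruence.
- eapply leaf_extension; eauto.
Qed.

Lemma independent_sym (u v : list bool) : independent u v -> independent v u.
Proof. intros I r; destruct (I r); auto. Qed.

Lemma under_longer (u p : list bool) : (length p < length u)%nat -> under u p = false.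
Proof.
intros L; apply not_true_iff_false; rewrite under_iff; intros [r ->].
rewrite length_app in L; lia.
Qed.

Lemma words_bounded (D : nat) :
  exists l : list (list bool), forall p, (length p <= D)%nat -> In p l.
Proof.
induction D as [|D [l IH]].
- exists [[]]; intros [|b p] H; simpl in *; auto; lia.
- exists ([] :: map (cons true) l ++ map (cons false) l).
  intros [|b p] H; simpl in *; auto; right; apply in_or_app.
  destruct b; [left|right]; apply in_map, IH; lia.
Qed.

(** Some finite list holds all words of length at most [D], so among one more symbol [(i, 0)] than
    its entries, injectivity forces a longer codeword. *)
Lemma deep_codeword (c : nat * nat -> list bool) (D : nat) :
  (forall a b, c a = c b -> a = b) -> exists a, (D < length (c a))%nat.
Proof.
intros Hinj; destruct (words_bounded D) as [l Hl].
destruct (Exists_dec (fun i => (D < length (c (i, 0%nat)))%nat) (seq 0 (S (length l))))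
  as [H|H].
- intro; apply lt_dec.
- apply Exists_exists in H; destruct H as (i & _ & H); eauto.
- exfalso; assert (A := proj2 (Forall_Exists_neg _ _) H); rewrite Forall_forall in A.
  assert (L : (length (map (fun i => c (i, 0%nat)) (seq 0 (S (length l)))) <= length l)%nat).
  { apply NoDup_incl_length.
    - apply NoDup_map_NoDup_ForallPairs; [|apply seq_NoDup].
      intros i j _ _ E; apply Hinj in E; congruence.
    - intros p Ip; apply in_map_iff in Ip; destruct Ip as (i & <- & Ii); apply Hl.
      specialize (A i Ii); lia. }
  rewrite length_map, length_seq in L; lia.
Qed.

(** If [c b] were two or more levels below [c a], its parent [z] would still be strictly deeper than
    [c a], hence at most as probable as [a]. But [z] covers [b], which is as probable as [a], and
    also a further symbol [e] of positive probability below the sibling of [c b]. *)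
Lemma equiprobable_lengths (q : R) (N : list bool -> Prop) (c : nat * nat -> list bool)
    (a b : nat * nat) :
  0 < q < 1 -> optimal q N c -> prob q a = prob q b ->
  (length (c b) <= length (c a) + 1)%nat.
Proof.
intros Hq Opt Eab; destruct (le_lt_dec (length (c b)) (length (c a) + 1)) as [|Lt]; auto.
exfalso; assert (PC : prefix_code N c) by apply Opt.
assert (PC' := PC); destruct PC' as (F & Hleaf & Hinj & _).
assert (Hz : exists z x, c b = z ++ [x]).
{ destruct (c b) as [|x z _] using rev_ind; [simpl in Lt; lia|eauto]. }
destruct Hz as (z & x & Ez).
assert (Nb : N (z ++ [x])) by (rewrite <- Ez; apply Hleaf).
assert (Ns := node_sibling _ _ _ F Nb).
assert (Nz := node_prefix _ _ _ F Nb).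
rewrite Ez, length_app in Lt; simpl in Lt.
assert (M : forall u, exists w, mass q c u w) by (intro; now apply weight_cv).
destruct (M (z ++ [negb x])) as [ws Hs].
(* Otherwise the sibling of [c b] has no codeword below it, and swapping it with
   the deeper codeword [c e] is an improvement. *)
assert (He : exists e, under (z ++ [negb x]) (c e) = true).
{ destruct (deep_codeword c (length (z ++ [negb x])) Hinj) as [e Le].
  destruct (under (z ++ [negb x]) (c e)) eqn:Ee; [eauto|].
  destruct (M (c e)) as [we Hwe].
  assert (prob q e <= ws).
  { rewrite <- (codeword_mass q N c e we); auto.
    apply (optimal_exchange q N c (z ++ [negb x]) (c e)); auto; [apply Hleaf|].
    now apply leaf_independent with N. }
  apply NNPP; intro no.
  assert (ws <= total q []).
  { apply (mass_le q c (z ++ [negb x])); auto; [constructor|].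
    intros a' Ha; exfalso; eauto. }
  assert (P := prob_pos q e Hq); simpl in *; lra. }
destruct He as [e He].
destruct (M z) as [wz Hwz], (M (c a)) as [wa Hwa].
assert (H1 : wz <= wa).
{ apply (optimal_exchange q N c (c a) z); auto; [apply Hleaf| |lia].
  apply independent_sym, leaf_independent with N; auto; apply under_longer; lia. }
assert (H2 := codeword_mass q N c a wa Hq PC Hwa).
assert (H3 : total q [b; e] <= wz).
{ apply under_iff in He; destruct He as [r Er].
  apply (mass_ge q c z); auto.
  - constructor; [|constructor; [intros []|constructor]]; intros [->|[]].
    rewrite Ez, <- app_assoc in Er; apply app_inv_head in Er.
    destruct x; discriminate.
  - intros a' [<-|[<-|[]]]; apply under_iff; [eauto|].
    rewrite Er, <- app_assoc; eauto. }
assert (P := prob_pos q e Hq); simpl in *; lra.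
Qed.

Lemma pigeonhole {A : Type} (f : A -> nat) (K : nat) (ls : list nat) (l : list A) :
  (forall a, In a l -> In (f a) ls) -> NoDup l -> (length ls * K < length l)%nat ->
  exists d l', length l' = K /\ NoDup l' /\ forall a, In a l' -> In a l /\ f a = d.
Proof.
revert l; induction ls as [|d ls IH]; intros l Hl D L.
- destruct l as [|a l]; simpl in L; [lia|]; destruct (Hl a); simpl; auto.
- assert (E := filter_length (fun a => Nat.eqb (f a) d) l); simpl in L.
  destruct (le_lt_dec K (length (filter (fun a => Nat.eqb (f a) d) l))) as [H|H].
  + exists d, (firstn K (filter (fun a => Nat.eqb (f a) d) l)).
    rewrite length_firstn; split; [lia|split].
    * apply NoDup_app_remove_r with (skipn K (filter (fun a => Nat.eqb (f a) d) l)).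
      rewrite firstn_skipn; now apply NoDup_filter.
    * intros a Ia.
      assert (Ia' : In a (filter (fun a => Nat.eqb (f a) d) l)).
      { rewrite <- (firstn_skipn K); apply in_or_app; auto. }
      apply filter_In in Ia'; destruct Ia' as [? Ef]; apply Nat.eqb_eq in Ef; auto.
  + destruct (IH (filter (fun a => negb (Nat.eqb (f a) d)) l)) as (d' & l' & L' & D' & H').
    * intros a Ia; apply filter_In in Ia; destruct Ia as [Ia Ef].
      destruct (Hl a Ia) as [->|]; auto; rewrite Nat.eqb_refl in Ef; discriminate.
    * now apply NoDup_filter.
    * lia.
    * exists d', l'; split; [|split]; auto; intros a Ia; destruct (H' a Ia) as [Ia' Ef].
      apply filter_In in Ia'; tauto.
Qed.

(** The antidiagonal has [s + 1] equiprobable symbols, and each codeword length differs by at most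
    one from that of [(0, s)]. This leaves three candidate lengths, whence the factor 3. *)
Lemma equal_length_antidiagonal (q : R) (N : list bool -> Prop)
    (c : nat * nat -> list bool) (K s : nat) :
  0 < q < 1 -> optimal q N c -> (3 * K <= s)%nat ->
  exists d l, length l = K /\ NoDup l /\
    forall a, In a l -> (fst a + snd a = s)%nat /\ length (c a) = d.
Proof.
intros Hq Opt Ls.
set (l0 := map (fun i => (i, (s - i)%nat)) (seq 0 (S s))).
assert (H0 : forall a, In a l0 -> (fst a + snd a = s)%nat).
{ intros a Ia; apply in_map_iff in Ia; destruct Ia as (i & <- & Ii).
  apply in_seq in Ii; simpl; lia. }
assert (Hp : forall a b, (fst a + snd a = s)%nat -> (fst b + snd b = s)%nat ->
  prob q a = prob q b) by (intros a b Ea Eb; unfold prob, tdgd; congruence).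
set (L := length (c (0, s)%nat)).
destruct (pigeonhole (fun a => length (c a)) K [(L - 1)%nat; L; (L + 1)%nat] l0)
  as (d & l & Ll & Dl & Hl).
- intros a Ia; apply H0 in Ia.
  assert (Ea := Hp a (0, s)%nat Ia eq_refl).
  assert (A1 := equiprobable_lengths _ _ _ _ _ Hq Opt Ea).
  assert (A2 := equiprobable_lengths _ _ _ _ _ Hq Opt (eq_sym Ea)).
  fold L in A1, A2; simpl; lia.
- apply NoDup_map_NoDup_ForallPairs; [|apply seq_NoDup]; intros i j _ _ E; congruence.
- unfold l0; rewrite length_map, length_seq; simpl; lia.
- exists d, l; split; [|split]; auto; intros a Ia; destruct (Hl a Ia); auto.
Qed.

(** * Comparing a gathered subtree with a single codeword *)

Lemma gather_symbols (M d : nat) (N : list bool -> Prop) (c : nat * nat -> list bool)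
    (l : list (nat * nat)) :
  prefix_code N c -> length l = (2 ^ M)%nat -> NoDup l ->
  (forall a, In a l -> length (c a) = d) ->
  exists N' c' u, prefix_code N' c' /\
    (forall a, length (c' a) = length (c a)) /\
    N' u /\ (length u + M = d)%nat /\
    (forall a, under u (c' a) = true <-> In a l).
Proof.
intros PC Ll Dl Hl; assert (PC' := PC); destruct PC' as (F & Hleaf & Hinj & _).
destruct (gather M d N c (map c l)) as (N' & c' & u & PC' & Lc & Nu & Lu & Hu); auto.
- now rewrite length_map.
- apply NoDup_map_NoDup_ForallPairs; auto; intros a b _ _; apply Hinj.
- intros x Ix; apply in_map_iff in Ix; destruct Ix as (a & <- & Ia).
  split; [apply Hleaf|auto].
- exists N', c', u; do 4 (split; auto); intro a; rewrite Hu; split.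
  + intros (x & Ix & Ux); apply in_map_iff in Ix; destruct Ix as (b & <- & Ib).
    apply (under_codeword N) in Ux; auto; now subst.
  + intros Ia; exists (c a); split; [now apply in_map|].
    apply under_refl.
Qed.

Lemma total_const (q p : R) (l : list (nat * nat)) :
  (forall a, In a l -> prob q a = p) ->
  total q l = INR (length l) * p.
Proof.
induction l as [|a l IH]; intros H; simpl total; simpl length.
- simpl; lra.
- rewrite S_INR, (H a), IH by (intros; try apply H; simpl; auto); lra.
Qed.

(** Gathering [l] keeps all lengths, hence optimality, and produces a node of probability
    [2 ^ M * p] at depth [d - M]. Since [b] is not in [l], its codeword is independent of that node.
    Being more probable, it cannot be strictly deeper. *)
Lemma likely_depth (q : R) (N : list bool -> Prop) (c : nat * nat -> list bool)
    (l : list (nat * nat)) (M d : nat) (p : R) (b : nat * nat) :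
  0 < q < 1 -> optimal q N c -> length l = (2 ^ M)%nat -> NoDup l -> ~ In b l ->
  (forall a, In a l -> prob q a = p /\ length (c a) = d) ->
  2 ^ M * p < prob q b -> (length (c b) + M <= d)%nat.
Proof.
intros Hq Opt Ll Dl nb Hl Hb.
destruct (gather_symbols M d N c l) as (N' & c' & u & PC & Lc & Nu & Lu & Hu);
  auto; [apply Opt|intros; now apply Hl|].
assert (Opt' := optimal_same_lengths _ _ _ _ _ Opt PC Lc).
assert (PC' := PC); destruct PC' as (F & Hleaf & _).
destruct (le_lt_dec (length (c b) + M) d) as [|Lt]; auto; exfalso.
destruct (weight_cv q (fun a => under u (c' a)) Hq) as [wu Hwu].
destruct (weight_cv q (fun a => under (c' b) (c' a)) Hq) as [wb Hwb].
assert (H1 : wb <= wu).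
{ apply (optimal_exchange q N' c' u (c' b)); auto; [apply Hleaf| |rewrite Lc; lia].
  apply leaf_independent with N'; auto; apply not_true_iff_false; now rewrite Hu. }
assert (H2 := mass_le q c' u wu l Hq Dl (fun a => proj1 (Hu a)) Hwu).
rewrite (total_const q p), Ll, pow_INR in H2 by (intros; now apply Hl).
change (INR 2) with 2 in H2.
rewrite (codeword_mass q N' c' b wb) in H1; auto; lra.
Qed.

(** The mirror image of [likely_depth]: here the gathered node is the more probable one, so it
    cannot be strictly deeper than the codeword of [b]. *)
Lemma unlikely_depth (q : R) (N : list bool -> Prop) (c : nat * nat -> list bool)
    (l : list (nat * nat)) (M d : nat) (p : R) (b : nat * nat) :
  0 < q < 1 -> optimal q N c -> length l = (2 ^ M)%nat -> NoDup l -> ~ In b l ->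
  (forall a, In a l -> prob q a = p /\ length (c a) = d) ->
  prob q b < 2 ^ M * p -> (d <= length (c b) + M)%nat.
Proof.
intros Hq Opt Ll Dl nb Hl Hb.
destruct (gather_symbols M d N c l) as (N' & c' & u & PC & Lc & Nu & Lu & Hu);
  auto; [apply Opt|intros; now apply Hl|].
assert (Opt' := optimal_same_lengths _ _ _ _ _ Opt PC Lc).
assert (PC' := PC); destruct PC' as (F & Hleaf & _).
destruct (le_lt_dec d (length (c b) + M)) as [|Lt]; auto; exfalso.
destruct (weight_cv q (fun a => under u (c' a)) Hq) as [wu Hwu].
destruct (weight_cv q (fun a => under (c' b) (c' a)) Hq) as [wb Hwb].
assert (H1 : wu <= wb).
{ apply (optimal_exchange q N' c' (c' b) u); auto; [apply Hleaf| |rewrite Lc; lia].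
  apply independent_sym, leaf_independent with N'; auto.
  apply not_true_iff_false; now rewrite Hu. }
assert (H2 := mass_ge q c' u wu l Hq Dl (fun a => proj2 (Hu a)) Hwu).
rewrite (total_const q p), Ll, pow_INR in H2 by (intros; now apply Hl).
change (INR 2) with 2 in H2.
rewrite (codeword_mass q N' c' b wb) in H1; auto; lra.
Qed.

(** * Choice of the exponents and the contradiction *)

(** Take [k] with [(q / q1) ^ k < 1/4], then [M] with [2 ^ M * q1 ^ k] in the interval from 1
    (excluded) to 2. The last quantity equals [2 * (q / q1) ^ k * (2 ^ M * q1 ^ k)], which is below
    [2 * 1/4 * 2 = 1]. *)
Lemma separating_powers (q q1 : R) : 0 < q < q1 -> q1 < 1 ->
  exists k M : nat, (0 < k)%nat /\ 1 < 2 ^ M * q1 ^ k /\ 2 ^ S M * q ^ k < 1.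
Proof.
intros H H1.
assert (Hr : 0 < q / q1 < 1).
{ split; [apply Rdiv_lt_0_compat; lra|]; apply Rmult_lt_reg_r with q1; [lra|].
  unfold Rdiv; rewrite Rmult_assoc, Rinv_l; lra. }
destruct (pow_lt_1_zero (q / q1)) with (y := 1 / 4) as [k Hk];
  [rewrite Rabs_right; lra|lra|].
specialize (Hk k (le_n k)).
assert (Pr : 0 < (q / q1) ^ k) by (apply pow_lt; lra).
rewrite Rabs_right in Hk by lra.
assert (P1 : 0 < q1 ^ k) by (apply pow_lt; lra).
assert (Eq : q ^ k = (q / q1) ^ k * q1 ^ k).
{ rewrite <- Rpow_mult_distr; f_equal; field; lra. }
assert (k0 : (0 < k)%nat) by (destruct k; simpl in Hk; [lra|lia]).
assert (Le1 : q1 ^ k <= 1) by (apply Rlt_le, pow_lt_1_compat; auto; lra).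
destruct (Pow_x_infinity 2) with (b := 2 / q1 ^ k) as [M0 HM0];
  [rewrite Rabs_right; lra|].
specialize (HM0 M0 (le_n _)).
assert (Big : 1 < 2 ^ M0 * q1 ^ k).
{ rewrite Rabs_right in HM0 by (apply Rle_ge, pow_le; lra).
  apply Rge_le, (Rmult_le_compat_r (q1 ^ k)) in HM0; [|lra].
  unfold Rdiv in HM0; rewrite Rmult_assoc, Rinv_l in HM0; lra. }
(* Descend from [M0] while the value stays above 1. Exponent 0 is excluded because [q1 ^ k <= 1],
   and one doubling of a value at most 1 gives at most 2. *)
assert (Step : exists M, 1 < 2 ^ M * q1 ^ k /\ 2 ^ M * q1 ^ k <= 2).
{ clear HM0; induction M0 as [|M0 IH]; simpl in Big; [lra|].
  destruct (Rlt_le_dec 1 (2 ^ M0 * q1 ^ k)) as [B|B]; [auto|].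
  exists (S M0); simpl; lra. }
destruct Step as (M & B1 & B2); exists k, M; split; [|split]; auto.
rewrite Eq; simpl; nra.
Qed.

(** The common depth [d] is found from optimality for [q], but it belongs to the code and so serves
    for [q1] as well. The two comparisons with [b] then give incompatible bounds on its codeword
    length. *)
Lemma not_both_optimal (q q1 : R) (N : list bool -> Prop) (c : nat * nat -> list bool) :
  0 < q < q1 -> q1 < 1 -> optimal q N c -> ~ optimal q1 N c.
Proof.
intros H H1 Opt Opt1.
destruct (separating_powers q q1 H H1) as (k & M & k0 & B1 & B).
(* Large enough for [2 ^ S M] equally long codewords on the antidiagonal, and at least [k], so that
   [s - k] is a true difference. *)
set (s := (k + 3 * 2 ^ S M)%nat).
destruct (equal_length_antidiagonal q N c (2 ^ S M) s) as (d & l & Ll & Dl & Hl);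
  [lra|auto|unfold s; lia|].
assert (E : forall r, r ^ s = r ^ k * r ^ (s - k))
  by (intro r; rewrite <- pow_add; f_equal; unfold s; lia).
(* Any symbol of the antidiagonal [s - k] would do. It lies outside [l] because [k] is positive. *)
set (b := ((s - k)%nat, 0%nat)).
assert (nb : ~ In b l) by (intro I; apply Hl in I; simpl in I; lia).
assert (Hp : forall r a, In a l -> prob r a = (1 - r) ^ 2 * r ^ s)
  by (intros r a Ia; unfold prob, tdgd; now rewrite (proj1 (Hl a Ia))).
assert (Hb : forall r, prob r b = (1 - r) ^ 2 * r ^ (s - k))
  by (intro r; unfold prob, tdgd, b; simpl fst; simpl snd; now rewrite Nat.add_0_r).
assert (A := likely_depth q N c l (S M) d ((1 - q) ^ 2 * q ^ s) b).
(* For [q1] only half of the symbols are gathered: the bound [1 < 2 ^ M * q1 ^ k] then makes the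
   gathered node more probable than [b], one level lower than the node used for [q]. *)
assert (A1 := unlikely_depth q1 N c (firstn (2 ^ M) l) M d ((1 - q1) ^ 2 * q1 ^ s) b).
assert (Hf : forall a, In a (firstn (2 ^ M) l) -> In a l).
{ intros a Ia; rewrite <- (firstn_skipn (2 ^ M)); apply in_or_app; auto. }
assert (P : forall r, 0 < r < 1 -> 0 < (1 - r) ^ 2 * r ^ (s - k))
  by (intros r Hr; rewrite <- Hb; now apply prob_pos).
enough (length (c b) + S M <= d /\ d <= length (c b) + M)%nat by lia.
split.
- apply A; auto; [lra| |].
  + intros a Ia; split; [auto|now apply Hl].
  + rewrite Hb, E; specialize (P q); nra.
- apply A1; auto; [lra| | | |].
  + rewrite length_firstn, Ll; simpl; lia.
  + apply NoDup_app_remove_r with (skipn (2 ^ M) l); now rewrite firstn_skipn.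
  + intros a Ia; split; [auto|now apply Hl, Hf].
  + rewrite Hb, E; specialize (P q1); nra.
Qed.

Theorem theorem1 (q q1 : R) (N : list bool -> Prop) (c : nat * nat -> list bool) :
  0 < q < 1 -> 0 < q1 < 1 -> q <> q1 ->
  prefix_code N c -> optimal q N c -> ~ optimal q1 N c.
Proof.
intros Hq Hq1 ne _ Opt Opt1; destruct (Rdichotomy q q1 ne).
- apply (not_both_optimal q q1 N c); auto; lra.
- apply (not_both_optimal q1 q N c); auto; lra.
Qed.
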